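(* (i) Every graph $G$ with maximum degree $\Delta(G)\in\{2,3\}$ satisfies $\chi_\ell^\star(G)\le \Delta(G)+1$. (ii) Every graph $G$ with maximum degree $\Delta(G)\in\{2,3,4\}$ satisfies $\chi_c^\star(G)\le 2\left\lceil \frac{\Delta(G)+1}{2}\right\rceil$.
   Context: A correspondence-cover of a graph $G$ is a pair $(L,H)$ where $H$ is a graph and $L:V(G)\to 2^{V(H)}$ is such that: the sets $L(v)$ partition $V(H)$; for distinct non-adjacent $u,v$ there are no edges of $H$ between $L(u)$ and $L(v)$; for $uv\in E(G)$ the edges of $H$ between $L(u)$ and $L(v)$ form a matching; each $L(v)$ induces a clique in $H$. It is $k$-fold if $|L(v)|=k$ for all $v$. A $k$-list-assignment $L$ assigns each vertex a set $L(v)\subseteq\mathbb{N}$ of size $k$; its list-cover has vertices $x_v$ ($v\in V(G)$, $x\in L(v)$), cliques on each $\{x_v:x\in L(v)\}$, and edges $x_ux_v$ for each $uv\in E(G)$ and $x\in L(u)\cap L(v)$. The list packing number $\chi_\ell^\star(G)$ is the least $k$ such that for every $k$-list-assignment the associated list-cover has chromatic number $k$ (equivalently, there are $k$ pairwise disjoint proper $L$-colourings). The correspondence packing number $\chi_c^\star(G)$ is the least $k$ such that every $k$-fold correspondence-cover $(L,H)$ of $G$ has $\chi(H)=k$. *)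

(* Defs.v *)
From HB Require Import structures.
From mathcomp Require Import all_boot finmap.

Set Implicit Arguments.
Unset Strict Implicit.
Unset Printing Implicit Defensive.

Record sgraph := SGraph {
  vertex :> finType;
  adj : rel vertex;
  adj_sym : symmetric adj;
  adj_irrefl : irreflexive adj
}.

Definition max_degree (G : sgraph) : nat :=
  \max_(v : G) #|[set w : G | adj v w]|.

Definition colorable (G : sgraph) (k : nat) : bool :=
  [exists f : {ffun G -> 'I_k},
     [forall x : G, forall y : G, adj x y ==> (f x != f y)]].

Lemma colorable_exists (G : sgraph) : exists k, colorable G k.
Proof.
exists #|G|; apply/existsP; exists [ffun x => enum_rank x].
apply/forallP => x; apply/forallP => y; apply/implyP => xy.
rewrite !ffunE (inj_eq enum_rank_inj).
by apply: contraL xy => /eqP->; rewrite adj_irrefl.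
Qed.

Definition chromatic_number (G : sgraph) : nat := ex_minn (colorable_exists G).

Record correspondence_cover (G H : sgraph) (L : G -> {set H}) : Prop := {
  cover_total : \bigcup_(v : G) L v = [set: H];
  cover_disjoint : forall u v : G, u != v -> [disjoint L u & L v];
  cover_nonadj : forall u v : G, u != v -> ~~ adj u v ->
    forall x y : H, x \in L u -> y \in L v -> ~~ adj x y;
  cover_matching : forall u v : G, adj u v ->
    forall x x' y y' : H,
      x \in L u -> x' \in L u -> y \in L v -> y' \in L v ->
      adj x y -> adj x' y' -> (x = x' <-> y = y');
  cover_clique : forall (v : G) (x y : H),
    x \in L v -> y \in L v -> x != y -> adj x y
}.

Definition kfold_cover (k : nat) (G H : sgraph) (L : G -> {set H}) : Prop :=
  correspondence_cover L /\ forall v : G, #|L v| = k.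

Definition list_assignment (k : nat) (G : sgraph) (L : G -> {fset nat}) : Prop :=
  forall v : G, #|` L v|%fset = k.

Section ListCover.
Variables (G : sgraph) (L : G -> {fset nat}).

(* The cover vertex x_v is [Tagged _ x] with tag v and x : L v. *)
Definition list_cover_vertex : finType := {v : G & L v}.

Definition list_cover_colour (p : list_cover_vertex) : nat := val (tagged p).

Definition list_cover_adj : rel list_cover_vertex := fun p q =>
  ((tag p == tag q) && (list_cover_colour p != list_cover_colour q))
  || (adj (tag p) (tag q) && (list_cover_colour p == list_cover_colour q)).

Lemma list_cover_adj_sym : symmetric list_cover_adj.
Proof.
move=> p q; rewrite /list_cover_adj adj_sym (eq_sym (tag p)).
by rewrite (eq_sym (list_cover_colour p)).
Qed.

Lemma list_cover_adj_irrefl : irreflexive list_cover_adj.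
Proof. by move=> p; rewrite /list_cover_adj adj_irrefl !eqxx. Qed.

Definition list_cover : sgraph :=
  SGraph list_cover_adj_sym list_cover_adj_irrefl.
End ListCover.

Definition list_packable (G : sgraph) (k : nat) : Prop :=
  forall L : G -> {fset nat},
    list_assignment k L -> chromatic_number (list_cover L) = k.

Definition correspondence_packable (G : sgraph) (k : nat) : Prop :=
  forall (H : sgraph) (L : G -> {set H}),
    kfold_cover k L -> chromatic_number H = k.

(* Positivity excludes k = 0: a 0-fold cover is the empty graph, whose
   chromatic number is 0, so 0 would be the least value for every graph. *)
Definition least_positive (P : nat -> Prop) (k : nat) : Prop :=
  [/\ 0 < k, P k & forall j, 0 < j -> P j -> k <= j].

Definition is_list_packing_number (G : sgraph) : nat -> Prop :=
  least_positive (list_packable G).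

Definition is_correspondence_packing_number (G : sgraph) : nat -> Prop :=
  least_positive (correspondence_packable G).

(* Main.v *)
Require Import Defs.
From mathcomp Require Import all_boot finmap.
From mathcomp Require Import all_fingroup ssralg zmodp zify.
From Stdlib Require Import Classical.

Set Implicit Arguments.
Unset Strict Implicit.
Unset Printing Implicit Defensive.

(** Enumerate each list by 'I_k and extend the matching over each edge to a
    permutation; k disjoint colourings then amount to a permutation p v in S_k
    per vertex such that, for each edge uv, p u transported to v is apart from
    p v, i.e. differs from it at every point.  By Hall's theorem a vertex with at
    most k/2 packed neighbours can always be packed.  Hence, by induction on the
    vertex set, only sets U inducing a (k/2 + 1)-regular graph (Delta = k/2 + 1)
    need an argument, and there it suffices to pack the whole of U except a few
    vertices, and then to finish with those simultaneously:
    - k = 6, Delta = 4: the two ends of an edge.  Each avoids three permutations,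
      and a first end is bad for the second only if it completes a 3 x 4 or 4 x 3
      Latin rectangle.  The rectangles that occur are so constrained that
      excluding at most two further cells at the first end avoids all of them.
    - k = 4, Delta = 3: a triangle, or an induced path on three vertices; both
      are finite searches in S_4.
    - k = 3, Delta = 2, lists: the two ends of an edge whose lists differ; if no
      edge has different lists, rotate a proper 3-colouring. *)

(** * Hall's theorem *)

Section Hall.
Variable T : finType.
Implicit Types (e F : rel T) (A B S R C : {set T}).

Definition neighbours e B S := [set y in B | [exists x in S, e x y]].

Lemma neighboursP e B S y :
  reflect (y \in B /\ exists2 x, x \in S & e x y) (y \in neighbours e B S).
Proof.
rewrite inE; apply: (iffP andP) => -[yB h]; split=> //.
  exact/exists_inP.
by apply/exists_inP.
Qed.

Lemma neighboursU e B S S' :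
  neighbours e B (S :|: S') =
  neighbours e B S :|: neighbours e (B :\: neighbours e B S) S'.
Proof.
apply/setP=> y; rewrite in_setU; apply/idP/idP.
  case/neighboursP=> yB [x]; rewrite in_setU => /orP[xS|xS'] exy.
    by apply/orP; left; apply/neighboursP; split=> //; exists x.
  case: (boolP (y \in neighbours e B S)) => //= yN.
  by apply/neighboursP; rewrite in_setD yN yB; split=> //; exists x.
case/orP=> /neighboursP[yB [x xS exy]]; apply/neighboursP; split.
- by [].
- by exists x; rewrite ?in_setU ?xS.
- by move: yB; rewrite in_setD => /andP[].
- by exists x; rewrite ?in_setU ?xS ?orbT.
Qed.

(** Induction on [#|A|]. If a nonempty proper [S] is tight, it is matched into its neighbourhood and
    [A :\: S] into the rest of [B]. Otherwise every such set has a neighbour to spare, so any edge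
    [x0], [y] can be matched and removed. *)
Theorem hall e A B :
    (forall S, S \subset A -> #|S| <= #|neighbours e B S|) ->
  exists2 f : T -> T, {in A &, injective f}
    & forall x, x \in A -> f x \in B /\ e x (f x).
Proof.
have [n] := ubnP #|A|; elim: n A B => // n IHn A B; rewrite ltnS => leAn hallA.
have [->|[x0 x0A]] := set_0Vmem A.
  by exists id => // x; rewrite inE.
have glue S (f g : T -> T) : S \subset A ->
    {in S &, injective f} -> {in A :\: S &, injective g} ->
    (forall x, x \in S -> f x \in neighbours e B S /\ e x (f x)) ->
    (forall x, x \in A :\: S -> g x \in B :\: f @: S /\ e x (g x)) ->
  exists2 f : T -> T, {in A &, injective f}
    & forall x, x \in A -> f x \in B /\ e x (f x).
  move=> sSA injf injg hf hg; exists (fun x => if x \in S then f x else g x).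
    have cross x y : x \in S -> y \in A -> y \notin S -> f x = g y -> x = y.
      move=> xS yA yS fxgy.
      have [|+ _] := hg y; first by rewrite in_setD yS.
      by rewrite in_setD -fxgy imset_f.
    move=> x y xA yA; case: ifP => xS; case: ifP => yS.
    - exact: injf.
    - by apply: cross => //; rewrite yS.
    - by move/esym=> /cross-> //; rewrite xS.
    - by apply: injg; rewrite in_setD ?xS ?yS.
  move=> x xA; case: ifP => xS.
    by have [/neighboursP[fB _] ?] := hf x xS.
  have [|+ ?] := hg x; first by rewrite in_setD xS.
  by rewrite in_setD => /andP[_ ?].
case: (boolP [exists S : {set T},
   [&& S \proper A, S != set0 & #|neighbours e B S| <= #|S|]]).
  case/existsP=> S /and3P[pSA S0 tightS]; have sSA := proper_sub pSA.
  have ltSA := proper_card pSA.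
  have [||f injf hf] := IHn S (neighbours e B S); first lia.
    move=> S' sS'; apply: leq_trans (hallA _ (subset_trans sS' sSA)) _.
    apply/subset_leq_card/subsetP=> y /neighboursP[yB [x xS' exy]].
    apply/neighboursP; split; last by exists x.
    by apply/neighboursP; split=> //; exists x => //; apply: (subsetP sS').
  have fS : f @: S = neighbours e B S.
    apply/eqP; rewrite eqEcard card_in_imset // tightS andbT.
    by apply/subsetP=> _ /imsetP[x xS ->]; case: (hf x xS).
  have [||g injg hg] := IHn (A :\: S) (B :\: neighbours e B S).
  - have := cardsID S A; rewrite (setIidPr sSA).
    by have := S0; rewrite -card_gt0; lia.
  - move=> S' sS'; have := hallA (S :|: S').
    have dSS' : S :&: S' = set0.
      apply/setP=> x; rewrite in_setI in_set0; apply/negbTE/negP.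
      by case/andP=> xS /(subsetP sS'); rewrite in_setD xS.
    rewrite neighboursU cardsU dSS' cards0 subUset sSA.
    rewrite (subset_trans sS') ?subsetDl // => /(_ isT) h.
    have := leq_trans h (leq_card_setU _ _); lia.
  - apply: (glue S f g) => //.
    by rewrite fS.
rewrite negb_exists => /forallP slack.
have [N0|[y /neighboursP[yB [_ /set1P-> ex0y]]]] :=
    set_0Vmem (neighbours e B [set x0]).
  by have := hallA [set x0]; rewrite N0 sub1set cards0 cards1 => /(_ x0A).
have [||g injg hg] := IHn (A :\ x0) (B :\ y).
- by have := cardsD1 x0 A; rewrite x0A; lia.
- move=> S sS; have [->|S0] := eqVneq S set0; first by rewrite cards0.
  have pSA : S \proper A by apply: sub_proper_trans (properD1 x0A).
  have := slack S; rewrite pSA S0 /= -ltnNge => ltS.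
  apply: leq_trans (_ : #|neighbours e B S :\ y| <= _).
    by have := cardsD1 y (neighbours e B S); lia.
  apply/subset_leq_card/subsetP=> z.
  rewrite in_setD1 => /andP[zy /neighboursP[zB h]].
  by apply/neighboursP; rewrite in_setD1 zy.
- apply: (glue [set x0] (fun=> y) g).
  + by rewrite sub1set.
  + by move=> ? ? /set1P-> /set1P->.
  + exact: injg.
  + move=> x /set1P->; split=> //; apply/neighboursP; split=> //.
    by exists x0; rewrite ?set11.
  + move=> x /hg[+ ->]; rewrite in_setD1 in_setD => /andP[zy ->]; split=> //.
    rewrite andbT; apply: contra zy => /imsetP[_ _ ->] //.
Qed.

(** The Frobenius-König theorem, from Hall's condition for the complement of [F]: if [S] violates
    it, [F] is full on [S] times the complement of its neighbourhood. *)
Corollary konig F :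
  (exists s : {perm T}, forall x, ~~ F x (s x)) \/
  exists R C, #|T| < #|R| + #|C|
    /\ forall x y, x \in R -> y \in C -> F x y.
Proof.
case: (boolP [forall S : {set T},
  #|S| <= #|neighbours (fun x y => ~~ F x y) setT S|]).
  move/forallP=> h; left.
  have [|f injf hf] := @hall (fun x y => ~~ F x y) setT setT.
    by move=> S _; exact: h.
  have injf' : injective f by move=> x y; apply: injf; rewrite inE.
  by exists (perm injf') => x; rewrite permE; case: (hf x) => //; rewrite inE.
rewrite negb_forall => /existsP[S]; rewrite -ltnNge => ltNS; right.
exists S, (~: neighbours (fun x y => ~~ F x y) setT S); split.
  have := cardsC (neighbours (fun x y => ~~ F x y) setT S); lia.
move=> x y xS; rewrite in_setC; apply: contraR => nF.
by apply/neighboursP; rewrite inE; split=> //; exists x.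
Qed.

(** A permutation satisfying the most pairs of [F] satisfies all: were [F x y] missed, composing
    with the transposition of [s x] and [y] would gain [x] and, [F] being a partial matching, lose
    no other point. *)
Lemma perm_extension F :
    (forall x y y', F x y -> F x y' -> y = y') ->
    (forall x x' y, F x y -> F x' y -> x = x') ->
  exists s : {perm T}, forall x y, F x y -> s x = y.
Proof.
move=> funF injF; pose sat (s : {perm T}) := [set x | F x (s x)].
case: (arg_maxnP (fun s => #|sat s|) (erefl : xpredT (1%g : {perm T}))) => s _ maxs.
exists s => x y Fxy; apply/eqP; apply/idPn => sxy.
pose s' := (s * tperm (s x) y)%g.
have : #|sat s'| <= #|sat s| := maxs s' isT.
rewrite leqNgt => /negP[]; apply: proper_card.
apply/properP; split; last first.
  exists x; rewrite inE; first by rewrite permM tpermL.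
  by apply: contra sxy => Fxsx; apply/eqP/(funF x).
apply/subsetP=> z; rewrite !inE permM => Fz; case: tpermP => // [szx|szy].
  by rewrite (perm_inj szx).
by case/eqP: sxy; rewrite -szy (injF x z y) // -szy.
Qed.

End Hall.

(** * Permutations that differ everywhere *)

Section Apart.
Variable T : finType.
Implicit Types (s t A B : {perm T}) (As : seq {perm T}) (R C : {set T}).

Definition apart s t := [forall x, s x != t x].

Lemma apartP s t : reflect (forall x, s x <> t x) (apart s t).
Proof. by apply: (iffP forallP) => h x; apply/eqP. Qed.

Lemma apartC s t : apart s t = apart t s.
Proof. by apply: eq_forallb => x; rewrite eq_sym. Qed.

Lemma apartMr s t r : apart (s * r) (t * r) = apart s t.
Proof. by apply: eq_forallb => x; rewrite !permM (inj_eq perm_inj). Qed.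

Lemma apartMl s t r : apart (r * s) (r * t) = apart s t.
Proof.
apply/apartP/apartP=> h x; last by rewrite !permM; apply: h.
by have := h (r^-1 x)%g; rewrite !permM permKV.
Qed.

Lemma apartV s t : apart s^-1 t^-1 = apart s t.
Proof.
rewrite -(apartMr _ _ t) mulVg -(apartMl _ _ s) mulgA mulgV mul1g mulg1.
exact: apartC.
Qed.

Definition covered As (D : seq (T * T)) : rel T :=
  fun x y => has (fun A : {perm T} => A x == y) As || ((x, y) \in D).

(** On the graph of each permutation [p] is injective into [Y], so that graph holds at most [#|Y|]
    pairs of [X]. Taking [p] to be either projection yields the row and the column count. *)
Lemma card_covered As D (p : T * T -> T) (X : {set T * T}) (Y : {set T}) :
    (forall A, A \in As ->
       {in [pred z : T * T | A z.1 == z.2] &, injective p}) ->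
    (forall z, z \in X -> p z \in Y /\ covered As D z.1 z.2) ->
  #|X| <= size As * #|Y| + size D.
Proof.
elim: As X => [|A As IH] X injp hX.
  apply: leq_trans (card_size D); apply/subset_leq_card/subsetP=> -[x y].
  by case/hX.
rewrite -(cardsID [set z | A z.1 == z.2] X) /= mulSn -addnA leq_add //.
  rewrite -(card_in_imset (f := p)); last first.
    move=> z z'; rewrite !inE => /andP[_ Az] /andP[_ Az'].
    by apply: (injp A); rewrite ?mem_head.
  by apply/subset_leq_card/subsetP=> _ /imsetP[z /setIP[/hX[? _] _] ->].
apply: IH => [A' A'As|z]; first by apply: injp; rewrite in_cons A'As orbT.
rewrite in_setD inE => /andP[nAz /hX[-> +]].
by rewrite /covered /= (negPf nAz).
Qed.

Lemma card_covered_block As D R C :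
    (forall x y, x \in R -> y \in C -> covered As D x y) ->
  #|R| * #|C| <= size As * #|R| + size D /\
  #|R| * #|C| <= size As * #|C| + size D.
Proof.
move=> cov; rewrite -cardsX.
split; [apply: (@card_covered As D fst) | apply: (@card_covered As D snd)].
- by move=> A _ [x y] [x' y']; rewrite !inE /= => /eqP<- /eqP<- ->.
- by case=> x y; rewrite in_setX => /andP[xR yC]; split=> //; apply: cov.
- move=> A _ [x y] [x' y']; rewrite !inE /= => /eqP + /eqP + yy'.
  by rewrite yy' => <- /perm_inj->.
- by case=> x y; rewrite in_setX => /andP[xR yC]; split=> //; apply: cov.
Qed.

(** A fully covered nonempty rectangle has both sides at most [size As], so its sides cannot sum to
    more than [#|T|]. *)
Lemma exists_apart As :
  2 * size As <= #|T| -> exists t, forall A, A \in As -> apart A t.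
Proof.
move=> leAs; case: (konig (covered As [::])) => [[t ht]|].
  exists t => A AAs; apply/apartP=> x Axt; case/negP: (ht x).
  by apply/orP; left; apply/hasP; exists A => //; apply/eqP.
case=> R [C [ltT /card_covered_block[]]]; rewrite /= !addn0.
have {ltT}: #|T| < #|R| + #|C| := ltT.
have: #|R| <= #|T| := max_card _; have: #|C| <= #|T| := max_card _.
move: #|R| #|C| (size As) leAs => r c a leAs lec ler ltT.
rewrite [r * c]mulnC leq_mul2r [c * r]mulnC leq_mul2r => *; exfalso; lia.
Qed.

(** If the sides [r], [c] are at most 6 and [r + c >= 7], then [r * (c - 3)] or [c * (r - 3)] is at
    least 3: the two cells of [D] cannot make up what three permutations leave uncovered. *)
Lemma exists_apart_cells As (D : seq (T * T)) :
    #|T| = 6 -> size As <= 3 -> size D <= 2 ->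
  exists2 s, forall A, A \in As -> apart A s
    & forall x y, (x, y) \in D -> s x <> y.
Proof.
move=> T6 leAs leD; case: (konig (covered As D)) => [[s hs]|].
  exists s => [A AAs|x y xyD sxy].
    apply/apartP=> x Axs; case/negP: (hs x).
    by apply/orP; left; apply/hasP; exists A => //; apply/eqP.
  by case/negP: (hs x); rewrite sxy /covered xyD orbT.
case=> R [C [ltT /card_covered_block[+ +]]].
have {ltT}: #|T| < #|R| + #|C| := ltT.
have: #|R| <= #|T| := max_card _; have: #|C| <= #|T| := max_card _.
rewrite T6; move: #|R| #|C| (size As) (size D) leAs leD => r c a d leAs leD.
have := leq_mul leAs (leqnn c); have := leq_mul leAs (leqnn r).
by case: r => [|[|[|[|[|[|[|r]]]]]]] *; exfalso; lia.
Qed.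

End Apart.

(** * Two adjacent vertices, six colours *)

Section Blocks.
Variable T : finType.
Implicit Types (s t : {perm T}) (B : 'I_3 -> {perm T}) (R C Q : {set T}).

(** [None] stands for [s], so that the four permutations form a single family. *)
Definition withs B s (o : option 'I_3) : {perm T} := if o is Some k then B k else s.

(* The graphs of B 0, B 1, B 2 and s tile the 3 x 4 rectangle R x C.  Such a
   rectangle, or its transpose, is the only obstruction to a permutation apart
   from all four. *)
Definition rowblock B s R C :=
  [/\ #|R| = 3, #|C| = 4
    & forall x y, x \in R -> y \in C -> exists o, withs B s o x = y].

(** Inverting the permutations transposes the rectangle: here [C] has three elements and [R] four,
    and results on row blocks carry over. *)
Definition colblock B s R C := rowblock (fun k => (B k)^-1)%g s^-1%g C R.

Lemma withsV B s o : withs (fun k => (B k)^-1)%g s^-1%g o = (withs B s o)^-1%g.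
Proof. by case: o. Qed.

Lemma colblockV B s R C :
  rowblock B s R C -> colblock (fun k => (B k)^-1)%g s^-1%g C R.
Proof.
case=> R3 C4 h; split=> // x y /h hx /hx[o <-]; exists o.
by rewrite !withsV invgK.
Qed.

(** Four permutations cover the four cells of a row, so each covers exactly one. *)
Lemma rowblockP B s R C x : rowblock B s R C -> x \in R ->
  (forall o, withs B s o x \in C) /\ injective (fun o => withs B s o x).
Proof.
case=> _ C4 h xR; pose g o := withs B s o x.
have sC : C \subset g @: setT.
  by apply/subsetP=> y /(h x y xR)[o <-]; apply: imset_f; rewrite inE.
have gT : #|[set: option 'I_3]| = 4 by rewrite cardsT card_option card_ord.
have eC : C = g @: setT.
  by apply/eqP; rewrite eqEcard sC C4 -gT leq_imset_card.
split=> [o|]; first by rewrite eC; apply: imset_f; rewrite inE.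
have /imset_injP gi : #|g @: setT| == #|[set: option 'I_3]| by rewrite -eC C4 gT.
by move=> o o'; apply: gi; rewrite inE.
Qed.

Lemma card_inj_le (I : finType) (f : I -> T) (A : {set T}) :
  injective f -> (forall i, f i \in A) -> #|I| <= #|A|.
Proof.
move=> injf fA; rewrite -(card_imset predT injf).
by apply/subset_leq_card/subsetP=> _ /imsetP[i _ ->].
Qed.

(** In a column [c] of [C'] outside [C], every row of [R'] except [s'^-1 c] has its cell covered by
    some [B k], and [B k] maps [R] into [C]; so that row is not in [R]. *)
Lemma rowblock_new_rows B s R C s' R' C' :
    rowblock B s R C -> rowblock B s' R' C' -> ~~ (C' \subset C) ->
  2 <= #|R' :\: R|.
Proof.
move=> rb rb' /subsetPn[c cC' cC]; have [R3 _ h] := rb'.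
have: #|R' :\ s'^-1%g c| <= #|R' :\: R|.
  apply/subset_leq_card/subsetP=> x; rewrite !inE => /andP[xc xR'].
  rewrite xR' andbT; apply: contra cC => xR.
  case: (h x c xR' cC') => -[k|] /= hx;
    first by rewrite -hx (proj1 (rowblockP rb xR) (Some k)).
  by rewrite -hx permK eqxx in xc.
by have := cardsD1 (s'^-1%g c) R'; rewrite R3; lia.
Qed.

Lemma rowblock_inj_rows B s R C s' R' C' c :
    rowblock B s R C -> rowblock B s' R' C' -> c \notin C ->
    (forall k, (B k)^-1%g c \in R') ->
  injective (fun k => (B k)^-1%g c).
Proof.
move=> rb rb' cC hc k l /= e.
have [_ inj] := rowblockP rb' (hc k).
have /= := inj (Some k) (Some l); rewrite permKV e permKV => /(_ erefl) [].
by [].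
Qed.

(** Blocks for the same [B] overlap heavily whatever [s] and [s'] are. Once [C = C'], the union of
    [R] and [R'] is mapped by [B 0] into the four elements of [C], which bounds it. *)
Lemma rowblock_unique B s R C s' R' C' :
    #|T| = 6 -> rowblock B s R C -> rowblock B s' R' C' ->
  C = C' /\ 2 <= #|R :&: R'|.
Proof.
move=> T6 rb rb'; have [R3 C4 _] := rb; have [R3' C4' _] := rb'.
have maxT (A : {set T}) : #|A| <= 6 by rewrite -T6 max_card.
have BC k x : x \in R -> B k x \in C
  by move=> xR; apply: (proj1 (rowblockP rb xR) (Some k)).
have BC' k x : x \in R' -> B k x \in C'
  by move=> xR; apply: (proj1 (rowblockP rb' xR) (Some k)).
have BVR k c : c \notin C -> (B k)^-1%g c \notin R.
  by apply: contra => /(BC k); rewrite permKV.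
have BVR' k c : c \notin C' -> (B k)^-1%g c \notin R'.
  by apply: contra => /(BC' k); rewrite permKV.
have eC : C = C'.
  apply/eqP; rewrite eq_sym eqEcard C4 C4' andbT; apply/idPn => nCC'.
  have := rowblock_new_rows rb rb' nCC'; have [c cC' cC] := subsetPn nCC'.
  have := cardsID R R'; have := cardsUI R R'; have := cardsUI C C'.
  rewrite R3 R3' C4 C4' [R' :&: R]setIC => cUI rUI.
  (* If [R] and [R'] are disjoint they exhaust the six points, hence so do [C] and [C'], which then
     share only two columns. *)
  have [RR'|[r]] := set_0Vmem (R :&: R').
    have RT x : (x \in R) || (x \in R').
      have := cardsC (R :|: R'); rewrite T6.
      have -> : #|R :|: R'| = 6 by move: rUI; rewrite RR' cards0; lia.
      by case=> /eqP; rewrite cards_eq0 => /eqP/setP/(_ x); rewrite !inE => /negbFE.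
    have CT y : (y \in C) || (y \in C').
      have := RT ((B ord0)^-1%g y); case/orP=> [/BC|/BC'] /(_ ord0);
        rewrite permKV => ->//.
      by rewrite orbT.
    have UC6 : #|C :|: C'| = 6.
      rewrite (_ : C :|: C' = setT) ?cardsT //.
      by apply/setP=> y; rewrite !inE CT.
    (* Otherwise no [B k] preimage of [s' x] is in [R], so [R'] would contain its four distinct
       preimages. *)
    have s'C x : x \in R' -> s' x \in C.
      move=> xR'; apply/idPn => s'x.
      pose g o := (withs B s' o)^-1%g (s' x).
      have gR' o : g o \in R'.
        case: o => [k|] /=; rewrite /g /= ?permK //.
        by have := RT ((B k)^-1%g (s' x)); rewrite (negPf (BVR k _ s'x)).
      have injg : injective g.
        move=> o o' e; have [_ inj] := rowblockP rb' (gR' o); apply: inj.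
        by rewrite {2}e /g !permKV.
      have := card_inj_le injg gR'; rewrite card_option card_ord R3'; lia.
    have : #|s' @: R'| <= #|C :&: C'|.
      apply/subset_leq_card/subsetP=> _ /imsetP[x xR' ->]; rewrite inE s'C //.
      exact: (proj1 (rowblockP rb' xR') None).
    by rewrite (card_imset _ perm_inj) R3'; lia.
  (* With a common row, a single row [z] lies outside both [R] and [R'], and some column [y] outside
     both [C] and [C']. All [B k] send [z] to [y], so the three distinct preimages of [c] must fit
     into the two rows of [R' :\: R]. *)
  rewrite inE => /andP[rR rR'] ID two.
  have r1 : 0 < #|R :&: R'| by apply/card_gt0P; exists r; rewrite inE rR.
  have c3 : 3 <= #|C :&: C'|.
    rewrite -[3]card_ord.
    apply: (card_inj_le (f := fun k => B k r)) => [k l e|k];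
      last by rewrite inE BC ?BC'.
    have [_ inj] := rowblockP rb rR; by have [] := inj (Some k) (Some l) e.
  have [y] : exists y, y \in ~: (C :|: C').
    by apply/card_gt0P; have := cardsC (C :|: C'); rewrite T6; lia.
  rewrite !inE negb_or => /andP[yC yC'].
  have z1 : #|~: (R :|: R')| = 1 by have := cardsC (R :|: R'); rewrite T6; lia.
  have /cards1P[z hz] := introT eqP z1.
  have Bz k : (B k)^-1%g y = z.
    by apply/set1P; rewrite -hz !inE negb_or BVR ?BVR'.
  have BcR' k : (B k)^-1%g c \in R' :\: R.
    rewrite inE BVR //=; apply: contraNT yC' => nR'.
    have : (B k)^-1%g c \in ~: (R :|: R') by rewrite !inE negb_or BVR.
    rewrite hz => /set1P; rewrite -(Bz k) => /perm_inj<-.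
    by rewrite cC'.
  have BcR'' k : (B k)^-1%g c \in R' by have := BcR' k; rewrite inE => /andP[].
  have := card_inj_le (rowblock_inj_rows rb rb' cC BcR'') BcR'.
  by rewrite card_ord; lia.
split=> //; have : #|B ord0 @: (R :|: R')| <= #|C|.
  apply/subset_leq_card/subsetP=> _ /imsetP[x + ->].
  by rewrite inE => /orP[xR|xR']; [apply: BC | rewrite eC; apply: BC'].
rewrite (card_imset _ perm_inj) C4; have := cardsUI R R'; rewrite R3 R3'; lia.
Qed.

(** Both [s x] and [s' x] are the one element of [C] that the [B k x] leave over. *)
Lemma rowblock_agree B s R s' R' C x :
    rowblock B s R C -> rowblock B s' R' C -> x \in R -> x \in R' ->
  s x = s' x.
Proof.
move=> rb rb' xR xR'; have [_ _ /(_ _ _ xR' (proj1 (rowblockP rb xR) None))] := rb'.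
case=> -[k|] //= e; have [_ inj] := rowblockP rb xR.
by have := inj (Some k) None e.
Qed.

(** The hypotheses on [Q] force [C'] into [C] and [R' = Q]. Then [R] and [s'^-1 C'] are
    three-element subsets of the four-element [Q], and [s] and [s'] agree wherever these meet. *)
Lemma row_col_agree B s R C s' R' C' Q :
    #|T| = 6 -> rowblock B s R C -> colblock B s' R' C' ->
    #|Q| = 4 -> R \subset Q -> (forall k x, x \in Q -> B k x \in C) ->
  2 <= #|R :&: [set x | s x == s' x]|.
Proof.
move=> T6 rb cb Q4 sRQ QC; have [R3 C4 _] := rb; have [C3' R4' _] := cb.
have cb_in k c : c \in C' -> (B k)^-1%g c \in R'.
  by move=> cC'; apply: (proj1 (rowblockP cb cC') (Some k)).
have cb_inj c : c \in C' -> injective (fun k => (B k)^-1%g c).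
  by move=> cC' k l e; have [_ inj] := rowblockP cb cC';
    have [] := inj (Some k) (Some l) e.
have cb_s c : c \in C' -> s'^-1%g c \in R'.
  by move=> cC'; apply: (proj1 (rowblockP cb cC') None).
have QB k : B k @: Q = C.
  apply/eqP; rewrite eqEcard (card_imset _ perm_inj) Q4 C4 leqnn andbT.
  by apply/subsetP=> _ /imsetP[x /QC-/(_ k) + ->].
have Q2 : #|~: Q| = 2 by have := cardsC Q; rewrite T6; lia.
have sC'C : C' \subset C.
  apply/subsetP=> c cC'; apply/idPn => cC.
  have : 3 <= #|~: Q|; last by lia.
  rewrite -[3]card_ord; apply: (card_inj_le (cb_inj c cC')) => k.
  by rewrite inE; apply: contra cC => /(QC k); rewrite permKV.
have BVQ k c : c \in C' -> (B k)^-1%g c \in Q.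
  move=> /(subsetP sC'C); rewrite -(QB k) => /imsetP[x xQ ->].
  by rewrite permK.
have eR' : R' = Q.
  apply/eqP; rewrite eqEcard Q4 R4' leqnn andbT; apply/idPn => nR'Q.
  have [x xR' xQ] := subsetPn nR'Q.
  have R'Q : #|R' :\: Q| <= 1.
    have : #|B ord0 @^-1: C'| <= #|R' :&: Q|.
      apply/subset_leq_card/subsetP=> z; rewrite !inE => zC'.
      by rewrite -(permK (B ord0) z) cb_in // BVQ.
    rewrite (_ : _ @^-1: _ = (B ord0)^-1%g @: C'); last first.
      apply/setP=> z; rewrite inE; apply/idP/imsetP => [zC'|[c cC' ->]].
        by exists (B ord0 z); rewrite ?permK.
      by rewrite permKV.
    by rewrite (card_imset _ perm_inj) C3'; have := cardsID Q R'; lia.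
  (* Otherwise [Q] contains all four preimages of [c], which make up [R'], and [x] is not in [Q]. *)
  have s'Q c : c \in C' -> s'^-1%g c \notin Q.
    move=> cC'; apply/negP => sQ.
    have : 4 <= #|R' :&: Q|.
      pose g o := withs (fun k => (B k)^-1)%g s'^-1%g o c.
      have -> : 4 = #|{: option 'I_3}| by rewrite card_option card_ord.
      apply: (@card_inj_le _ g); first exact: (proj2 (rowblockP cb cC')).
      by case=> [k|]; rewrite inE /g /= ?cb_in ?BVQ ?cb_s.
    have := cardsID Q R'; have : 0 < #|R' :\: Q|
      by apply/card_gt0P; exists x; rewrite inE xQ.
    lia.
  have : #|s'^-1%g @: C'| <= #|R' :\: Q|.
    apply/subset_leq_card/subsetP=> _ /imsetP[c cC' ->].
    by rewrite inE s'Q ?cb_s.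
  by rewrite (card_imset _ perm_inj) C3'; lia.
have : 2 <= #|R :&: (s'^-1%g @: C')|.
  have : #|R :|: (s'^-1%g @: C')| <= #|Q|.
    apply/subset_leq_card; rewrite subUset sRQ /= -eR'.
    by apply/subsetP=> _ /imsetP[c cC' ->]; apply: cb_s.
  have := cardsUI R (s'^-1%g @: C'); rewrite (card_imset _ perm_inj) R3 C3' Q4; lia.
move/leq_trans; apply; apply/subset_leq_card/subsetP=>
  x /setIP[xR /imsetP[c cC' xc]].
have cx : c = s' x by rewrite xc permKV.
rewrite inE xR inE /=; have [_ _ /(_ _ _ xR (subsetP sC'C _ cC'))] := rb.
(* The cell of row [x] in column [s' x] is not covered by any [B k], because [s'] covers it in the
   column block; so [s] covers it. *)
case=> -[k|] /= e; last by rewrite e cx.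
have [_ inj] := rowblockP cb cC'.
by have := inj (Some k) None; rewrite /= -xc -e permK => /(_ erefl).
Qed.
End Blocks.

(** * Choosing a first end that leaves room for the second *)

Section Six.
Variable T : finType.
Implicit Types (s t : {perm T}) (B : 'I_3 -> {perm T}) (R C Q : {set T}).
Implicit Types (As : seq {perm T}).

Lemma subset_of_card (A : {set T}) k :
  k <= #|A| -> exists2 S : {set T}, S \subset A & #|S| = k.
Proof.
move=> leAk; exists [set x in take k (enum A)].
  by apply/subsetP=> x; rewrite inE => /mem_take; rewrite mem_enum.
rewrite cardsE; have /card_uniqP-> : uniq (take k (enum A))
  by rewrite take_uniq ?enum_uniq.
by rewrite size_takel // -cardE.
Qed.

(** A rectangle covered by four permutations has sides at most 4; as they sum to at least 7, it
    contains a 3 x 4 or a 4 x 3 one. *)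
Lemma blocked B s :
    #|T| = 6 ->
    (forall t, apart s t -> (forall k, apart (B k) t) -> False) ->
  exists R C, rowblock B s R C \/ colblock B s R C.
Proof.
move=> T6 noT; pose As := [seq withs B s o | o : option 'I_3].
have As4 : size As = 4 by rewrite size_map -cardE card_option card_ord.
case: (konig (covered As [::])) => [[t ht]|].
  have apt o : apart (withs B s o) t.
    apply/apartP=> x e; case/negP: (ht x); apply/orP; left; apply/hasP.
    by exists (withs B s o); [apply: image_f | apply/eqP].
  by case: (noT t); [exact: (apt None) | move=> k; exact: (apt (Some k))].
case=> R [C [ltT cov]]; have {ltT}: #|T| < #|R| + #|C| := ltT.
have h x y : x \in R -> y \in C -> exists o, withs B s o x = y.
  move=> xR yC; have := cov x y xR yC; rewrite /covered in_nil orbF.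
  by case/hasP=> _ /imageP[o _ ->] /eqP; exists o.
have := card_covered_block cov; rewrite As4 /= !addn0 => -[].
rewrite [_ * #|C|]mulnC leq_mul2r [_ * #|R|]mulnC leq_mul2r T6 => r4 c4 lt6.
have shrink : (3 <= #|R| /\ 4 <= #|C|) \/ (4 <= #|R| /\ 3 <= #|C|).
  by have: #|R| <= #|T| := max_card _; have: #|C| <= #|T| := max_card _; lia.
case: shrink => -[/subset_of_card[R' sR cR] /subset_of_card[C' sC cC]];
  exists R', C'; [left | right]; split=> // x y.
  by move=> /(subsetP sR) xR /(subsetP sC); apply: h.
move=> /(subsetP sC) xC /(subsetP sR) yR; have [o <-] := h _ _ yR xC.
by exists o; rewrite withsV permK.
Qed.

(** Forbidding the cells of [s0] in two of the three rows of [R0] gives an [s1] that agrees with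
    [s0] at most once on [R0]. Every kind of block for [s1], or for a further choice [s2], forces
    two agreements. *)
Lemma exists_apart_pair_aux As B s0 R0 C0 :
    #|T| = 6 -> size As <= 3 ->
    (forall s, (forall A, A \in As -> apart A s) ->
       exists R C, rowblock B s R C \/ colblock B s R C) ->
  rowblock B s0 R0 C0 -> False.
Proof.
move=> T6 As3 allbad rb0; have [R03 C04 _] := rb0.
have BC k x : x \in R0 -> B k x \in C0
  by move=> xR; apply: (proj1 (rowblockP rb0 xR) (Some k)).
have [r1 [r2 [r1R r2R r12]]] : exists r1 r2, [/\ r1 \in R0, r2 \in R0 & r1 != r2].
  by apply/card_gt1P; rewrite R03.
have no_agree s : s r1 <> s0 r1 -> s r2 <> s0 r2 ->
    2 <= #|R0 :&: [set x | s0 x == s x]| -> False.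
  move=> n1 n2 le2.
  have : R0 :&: [set x | s0 x == s x] \subset R0 :\ r1 :\ r2.
    apply/subsetP=> x; rewrite !inE => /andP[-> /eqP e]; rewrite andbT.
    by apply/andP; split; apply/eqP=> xr; subst x; [apply: n2 | apply: n1].
  move/subset_leq_card; have := cardsD1 r1 R0; have := cardsD1 r2 (R0 :\ r1).
  by rewrite !inE r1R r2R eq_sym r12 R03 /=; lia.
have meets s R C : rowblock B s R C -> C0 = C /\ 2 <= #|R0 :&: R|.
  by move=> rb; apply: rowblock_unique T6 rb0 rb.
have [|s1 As1 D1] := exists_apart_cells (D := [:: (r1, s0 r1); (r2, s0 r2)]) T6 As3.
  by [].
have n1 : s1 r1 <> s0 r1 by apply: D1; rewrite !inE eqxx.
have n2 : s1 r2 <> s0 r2 by apply: D1; rewrite !inE eqxx orbT.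
have [R1 [C1 [rb1|cb1]]] := allbad s1 As1.
  have [eC le2] := meets _ _ _ rb1; rewrite -eC in rb1.
  apply: (no_agree s1) => //; apply: leq_trans le2 _.
  apply/subset_leq_card/subsetP=> x; rewrite !inE => /andP[xR xR1].
  by rewrite xR (rowblock_agree rb0 rb1 xR xR1) /=.
have [C13 R14 _] := cb1.
have [c cC1] : exists c, c \in C1 by apply/card_gt0P; rewrite C13.
(* [s1] has a column block. One forbidden cell lies in the row block of [s0], the other in the
   column block of [s1], so that the block of [s2], whichever its kind, differs from the earlier one
   of that kind. *)
have [|s2 As2 D2] :=
    exists_apart_cells (D := [:: (r1, s0 r1); (s1^-1%g c, c)]) T6 As3; first by [].
have m1 : s2 r1 <> s0 r1 by apply: D2; rewrite !inE eqxx.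
have m2 : s2 (s1^-1%g c) <> c by apply: D2; rewrite !inE eqxx orbT.
have [R2 [C2 [rb2|cb2]]] := allbad s2 As2.
  have [eC le2] := meets _ _ _ rb2; rewrite -eC in rb2.
  (* The row blocks of [s0] and [s2] share all columns but not the row [r1], so their rows form a
     four-element set that serves as [Q]. *)
  have r1R2 : r1 \notin R2.
    by apply/negP=> r1R2; apply: m1; rewrite (rowblock_agree rb0 rb2 r1R r1R2).
  have [R23 _ _] := rb2.
  have BC2 k x : x \in R2 -> B k x \in C0.
    by move=> xR; apply: (proj1 (rowblockP rb2 xR) (Some k)).
  have BC02 k x : x \in R0 :|: R2 -> B k x \in C0
    by case/setUP; [apply: BC | apply: BC2].
  apply: (no_agree s1) => //;
    apply: (row_col_agree T6 rb0 cb1 (Q := R0 :|: R2)) => //.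
    have : #|B ord0 @: (R0 :|: R2)| <= #|C0|.
      by apply/subset_leq_card/subsetP=> _ /imsetP[x xU ->]; apply: BC02.
    rewrite (card_imset _ perm_inj) C04.
    have : R0 :&: R2 \subset R0 :\ r1.
      apply/subsetP=> x; rewrite !inE => /andP[-> xR2]; rewrite andbT.
      by apply: contraNneq r1R2 => <-.
    move/subset_leq_card; have := cardsD1 r1 R0; rewrite r1R R03.
    by have := cardsUI R0 R2; rewrite R03 R23; lia.
  exact: subsetUl.
have [C23 R24 _] := cb2.
have [eR le2] := rowblock_unique T6 cb1 cb2; rewrite -eR in cb2.
(* Dually, the columns of the two column blocks together number four, and each [B k] maps [R1] onto
   them; [R1] will serve as [Q]. *)
have cC2 : c \notin C2.
  apply/negP=> cC2; apply: m2; have := rowblock_agree cb1 cb2 cC1 cC2 => e.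
  by rewrite e permKV.
have cb_in k y : y \in C1 :|: C2 -> (B k)^-1%g y \in R1.
  case/setUP=> yC; first exact: (proj1 (rowblockP cb1 yC) (Some k)).
  exact: (proj1 (rowblockP cb2 yC) (Some k)).
have C12 : #|C1 :|: C2| = 4.
  have : #|(B ord0)^-1%g @: (C1 :|: C2)| <= #|R1|.
    by apply/subset_leq_card/subsetP=> _ /imsetP[x xU ->]; apply: cb_in.
  rewrite (card_imset _ perm_inj) R14.
  have : C1 :&: C2 \subset C1 :\ c.
    apply/subsetP=> x; rewrite !inE => /andP[-> xC2]; rewrite andbT.
    by apply: contraNneq cC2 => <-.
  move/subset_leq_card; have := cardsD1 c C1; rewrite cC1 C13.
  by have := cardsUI C1 C2; rewrite C13 C23; lia.
have R1P k x : (x \in R1) = (B k x \in C1 :|: C2).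
  have -> : R1 = (B k)^-1%g @: (C1 :|: C2).
    apply/eqP; rewrite eq_sym eqEcard (card_imset _ perm_inj) C12 R14 leqnn andbT.
    by apply/subsetP=> _ /imsetP[y yU ->]; apply: cb_in.
  by rewrite -{1}(permK (B k) x) (mem_imset _ _ perm_inj).
have inj0 x : x \in R0 -> injective (fun k => B k x).
  by move=> xR k l e; have [_ inj] := rowblockP rb0 xR;
    have [] := inj (Some k) (Some l) e.
have sR01 : R0 \subset R1.
  apply/subsetP=> x xR0; apply/idPn => xR1.
  have : 3 <= #|~: (C1 :|: C2)|.
    by rewrite -[3]card_ord; apply: card_inj_le (inj0 x xR0) _ => k;
      rewrite inE -R1P.
  by have := cardsC (C1 :|: C2); rewrite C12 T6; lia.
have eC0 : C0 = C1 :|: C2.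
  apply/eqP; rewrite eqEcard C12 C04 leqnn andbT; apply/subsetP=> y yC0.
  (* The injective [s0] takes the value [y] in at most one of the rows [r1], [r2]; in the other row
     some [B k] does. *)
  have [x xR0 [k <-]] : exists2 x, x \in R0 & exists k, B k x = y.
    have [_ _ h] := rb0.
    have [[k|] e1] := h r1 y r1R yC0; first by exists r1 => //; exists k.
    have [[k|] e2] := h r2 y r2R yC0; first by exists r2 => //; exists k.
    by case/eqP: r12; apply: (@perm_inj _ s0); rewrite /= in e1 e2; rewrite e1 e2.
  by rewrite -R1P (subsetP sR01).
apply: (no_agree s1) => //; apply: (row_col_agree T6 rb0 cb1 (Q := R1)) => //.
by move=> k x xR1; rewrite eC0 -R1P.
Qed.

(** If no pair exists, every admissible [s] is blocked. A column block of [s0] becomes a row block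
    after inverting all permutations. *)
Lemma exists_apart_pair As B :
    #|T| = 6 -> size As <= 3 ->
  exists s t, [/\ forall A, A \in As -> apart A s, forall k, apart (B k) t &
    apart s t].
Proof.
move=> T6 As3.
have [s0 As0 _] := exists_apart_cells (D := [::]) T6 As3 isT.
have [|none] := boolP [exists s, exists t,
  [&& [forall (A | A \in As), apart A s], [forall k, apart (B k) t] & apart s t]].
  case/existsP=> s /existsP[t /and3P[/forall_inP h1 /forallP h2 h3]].
  by exists s, t.
exfalso.
have bad s : (forall A, A \in As -> apart A s) ->
    exists R C, rowblock B s R C \/ colblock B s R C.
  move=> hs; apply: (blocked T6) => t st Bt; case/negP: none.
  apply/existsP; exists s; apply/existsP; exists t; apply/and3P; split=> //.
    exact/forall_inP.
  exact/forallP.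
have [R [C [rb|cb]]] := bad s0 As0;
  first exact: exists_apart_pair_aux T6 As3 bad rb.
apply: (exists_apart_pair_aux (As := [seq A^-1%g | A <- As]) T6 _ _ cb);
  first by rewrite size_map.
move=> s hs; have [|R' [C' [rb'|cb']]] := bad s^-1%g.
- move=> A AAs; rewrite -[A]invgK apartV; apply: hs.
  by apply/mapP; exists A.
- by exists C', R'; right; move: (colblockV rb'); rewrite invgK.
- by exists C', R'; left; move: cb'; rewrite /colblock invgK.
Qed.
End Six.

(** * Searches in small symmetric groups *)

Section Words.
Variable k : nat.
Implicit Types s t : 'S_k.

(** One-line notation, on which the finite searches compute. *)
Definition word s : seq nat := [seq val (s i) | i <- enum 'I_k].
Definition words : seq (seq nat) := permutations (iota 0 k).

Lemma nth_word s (i : 'I_k) : nth 0 (word s) i = s i.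
Proof. by rewrite (nth_map i) ?size_enum_ord // nth_ord_enum. Qed.

Lemma size_word s : size (word s) = k.
Proof. by rewrite size_map size_enum_ord. Qed.

Lemma word_in_words s : word s \in words.
Proof.
rewrite mem_permutations -val_enum_ord uniq_perm //.
- by rewrite map_inj_uniq ?enum_uniq // => i j /val_inj/perm_inj.
- by rewrite map_inj_uniq ?enum_uniq //; apply: val_inj.
move=> x; apply/mapP/mapP => -[i _ ->].
  by exists (s i); rewrite ?mem_enum.
by exists (s^-1%g i); rewrite ?mem_enum ?permKV.
Qed.

Lemma word_surj w : w \in words -> exists s, word s = w.
Proof.
rewrite mem_permutations => pw.
have sw : size w = k by rewrite (perm_size pw) size_iota.
have ltw (i : 'I_k) : nth 0 w i < k.
  by have := mem_nth 0 (s := w) (n := i); rewrite (perm_mem pw) mem_iota sw; apply.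
have uw : uniq w by rewrite (perm_uniq pw) iota_uniq.
have injf : injective (fun i => Ordinal (ltw i)).
  move=> i j [] /eqP; rewrite nth_uniq ?sw // => /eqP; exact: val_inj.
exists (perm injf); apply: (@eq_from_nth _ 0); rewrite size_word ?sw // => i ltik.
by rewrite -[i]/(val (Ordinal ltik)) nth_word permE.
Qed.

Lemma word1 : word 1%g = iota 0 k.
Proof. by rewrite -val_enum_ord; apply: eq_map => i; rewrite perm1. Qed.

Lemma wordM s t : word (s * t)%g = [seq nth 0 (word t) x | x <- word s].
Proof. by rewrite -map_comp; apply: eq_map => i /=; rewrite permM nth_word. Qed.

Lemma all2_word (r : rel nat) s t :
  reflect (forall i, r (s i) (t i)) (all2 r (word s) (word t)).
Proof.
rewrite all2E !size_word eqxx zip_map all_map; apply: (iffP allP) => h i /=.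
  by apply: (h i); rewrite mem_enum.
by move=> _; apply: h.
Qed.

Definition wapart : rel (seq nat) := all2 (fun x y => ~~ eqn x y).

Lemma apart_word s t : apart s t = wapart (word s) (word t).
Proof.
apply/apartP/all2_word => h i; have := h i; rewrite eqnE.
  by move=> ?; apply/eqP => /val_inj.
by move=> /eqP + e; rewrite e.
Qed.

End Words.

(** The constraint on the middle vertex is normalised to the identity, so [D] consists of
    derangements. An end matters only through its set of candidates; [L] lists these sets without
    repetition to shorten the search. *)
Definition path_check (P : seq (seq nat)) : bool :=
  let D := [seq t <- P | wapart (iota 0 4) t] in
  let L := undup [seq [seq w <- P | wapart a w && wapart b w] | a <- P, b <- P] in
  all (fun la => all (fun lb =>
    has (fun a => has (fun b =>
      has (fun t => wapart a t && wapart b t) D) lb) la) L) L.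

(** With two edges of the triangle straightened, [r] is the permutation left on the third; the first
    constraint is normalised to the identity. *)
Definition triangle_check (P : seq (seq nat)) : bool :=
  let D := [seq t <- P | wapart (iota 0 4) t] in
  all (fun r => all (fun b => all (fun c =>
    has (fun x => has (fun y =>
      [&& wapart b y, wapart (map (nth 0 r) x) y &
        has (fun t => [&& wapart c t, wapart x t & wapart y t]) P]) P) D) P) P) P.

(** The permutations [s] and [t] may agree at the value [x], which stands for a colour without
    conflict across the edge. *)
Definition edge_check (P : seq (seq nat)) : bool :=
  all (fun a => all (fun b => all (fun x =>
    has (fun s => has (fun t =>
      [&& wapart a s, wapart b t &
          all2 (fun i j => ~~ eqn i j || eqn i x) s t]) P) P)
   (iota 0 3)) P) P.

(* [lazy] because [vm_compute] evaluates both arguments of &&, which ruins the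
   short-circuited searches. *)
Lemma path_checked : path_check (words 4).
Proof. by lazy. Qed.

Lemma triangle_checked : triangle_check (words 4).
Proof. by lazy. Qed.

Lemma edge_checked : edge_check (words 3).
Proof. by lazy. Qed.

Lemma path_perms (A1 A2 B1 B2 C : 'S_4) : exists a b t,
  [/\ apart A1 a, apart A2 a, apart B1 b & apart B2 b] /\
  [/\ apart C t, apart a t & apart b t].
Proof.
(* Right multiplication preserves [apart] and reduces to [C = 1]. *)
suff /(_ (A1 * C^-1) (A2 * C^-1) (B1 * C^-1) (B2 * C^-1))%g :
  forall A1 A2 B1 B2 : 'S_4,
    exists a b t, [/\ apart A1 a, apart A2 a, apart B1 b & apart B2 b] /\
      [/\ apart 1%g t, apart a t & apart b t].
  have e X y : apart (X * C^-1)%g y = apart X (y * C)%g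
    by rewrite -(apartMr _ _ C) mulgKV.
  case=> a [b [t H]]; exists (a * C)%g, (b * C)%g, (t * C)%g; move: H.
  by rewrite !e !apartMr -(apartMr 1%g t C) mul1g.
move=> {A1 A2 B1 B2 C} A1 A2 B1 B2.
pose cand (A A' : 'S_4) :=
  [seq w <- words 4 | wapart (word A) w && wapart (word A') w].
have candL A A' : cand A A' \in
    undup [seq [seq w <- words 4 | wapart a w && wapart b w] |
      a <- words 4, b <- words 4].
  by rewrite mem_undup; apply: (allpairs_f
    (fun a b => [seq w <- words 4 | wapart a w && wapart b w]));
    apply: word_in_words.
have /allP/(_ _ (candL A1 A2))/allP/(_ _ (candL B1 B2)) := path_checked.
case/hasP=> wa; rewrite mem_filter => /andP[/andP[A1a A2a] /word_surj[a ea]].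
case/hasP=> wb; rewrite mem_filter => /andP[/andP[B1b B2b] /word_surj[b eb]].
case/hasP=> wt; rewrite mem_filter => /andP[t1 /word_surj[t et]] /andP[at_ bt].
by exists a, b, t; rewrite !apart_word word1 ea eb et.
Qed.

Lemma triangle_perms (A B C r : 'S_4) : exists a b t,
  [/\ apart A a, apart B b & apart C t] /\
  [/\ apart (a * r) b, apart a t & apart b t].
Proof.
(* Since [r] acts on the right, [A] is normalised by left multiplication. *)
suff /(_ (A^-1 * B) (A^-1 * C))%g : forall B C : 'S_4, exists a b t,
    [/\ apart 1%g a, apart B b & apart C t] /\
    [/\ apart (a * r) b, apart a t & apart b t].
  have e X y : apart (A^-1 * X)%g y = apart X (A * y)%g
    by rewrite -(apartMl _ _ A) mulKVg.
  case=> a [b [t H]]; exists (A * a)%g, (A * b)%g, (A * t)%g; move: H.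
  by rewrite !e -mulgA !apartMl -(apartMl 1%g a A) mulg1.
move=> {A B C} B C; have /allP/(_ _ (word_in_words r)) := triangle_checked.
move=> /allP/(_ _ (word_in_words B))/allP/(_ _ (word_in_words C)).
case/hasP=> wa; rewrite mem_filter => /andP[a1 /word_surj[a ea]].
case/hasP=> wb /word_surj[b eb] /and3P[Bb arb].
case/hasP=> wt /word_surj[t et] /and3P[Ct at_ bt].
by exists a, b, t; rewrite !apart_word wordM word1 ea eb et.
Qed.

Lemma edge_perms (A B : 'S_3) (z : 'I_3) : exists s t,
  [/\ apart A s, apart B t & forall i, s i = t i -> s i = z].
Proof.
have /allP/(_ _ (word_in_words A))/allP/(_ _ (word_in_words B))
  /allP/(_ (z : nat)) :=
  edge_checked.
rewrite mem_iota ltn_ord => /(_ isT)/hasP[ws /word_surj[s es]].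
case/hasP=> wt /word_surj[t et] /and3P[As Bt]; rewrite -es -et => /all2_word st.
exists s, t; rewrite !apart_word es et; split=> // i sti; apply: val_inj.
by have := st i; rewrite sti eqnE eqxx => /eqP.
Qed.

(** * Packings of graphs with conflict matchings *)

Lemma mem_size1 (T : eqType) (x0 x : T) (s : seq T) :
  size s <= 1 -> x \in s -> x = nth x0 s 0.
Proof. by case: s => [|y [|]] //= _; rewrite inE => /eqP. Qed.

Lemma mem_size2 (T : eqType) (x0 x : T) (s : seq T) :
  size s <= 2 -> x \in s -> x = nth x0 s 0 \/ x = nth x0 s 1.
Proof.
case: s => [|y [|z [|]]] //= _; rewrite !inE; first by move/eqP; left.
by case/orP=> /eqP; [left | right].
Qed.

Definition degree_in (G : sgraph) (U : {set G}) (v : G) :=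
  #|[set u in U | adj v u]|.

Lemma degree_in_max (G : sgraph) (U : {set G}) v : degree_in U v <= max_degree G.
Proof.
apply: leq_trans (leq_bigmax v).
by apply/subset_leq_card/subsetP=> u; rewrite !inE => /andP[].
Qed.

Lemma degree_inD1 (G : sgraph) (U : {set G}) v a :
  degree_in U v = (a \in U) && adj v a + degree_in (U :\ a) v.
Proof.
rewrite /degree_in (cardsD1 a) !inE; congr (_ + #|pred_of_set _|).
by apply/setP=> u; rewrite !inE andbA.
Qed.

Definition update (T : eqType) S (f : T -> S) v s :=
  fun u => if u == v then s else f u.

Section Packing.
Variables (G : sgraph) (k : nat) (K : G -> G -> rel 'I_k).
Implicit Types (u v : G) (U W : {set G}) (p : G -> 'S_k).

(** [p v i] is the colour of [v] in the [i]-th colouring, and [K u v] is the conflict relation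
    between the colours of [u] and [v]. *)
Definition packs p U := forall u v, u \in U -> v \in U -> adj u v ->
  forall i, ~~ K u v (p u i) (p v i).

Hypothesis K_sym : forall u v x y, K u v x y = K v u y x.
Hypothesis K_matching :
  forall u v, adj u v -> exists s : 'S_k, forall x y, K u v x y -> s x = y.

Definition extension u v : 'S_k :=
  odflt 1%g [pick s : 'S_k | [forall x, forall y, K u v x y ==> (s x == y)]].

Lemma extensionP u v x y : adj u v -> K u v x y -> extension u v x = y.
Proof.
move=> uv; rewrite /extension; case: pickP => [s /forallP/(_ x)/forallP/(_ y)|none].
  by move=> /implyP h /h/eqP.
have [s hs] := K_matching uv; move: (none s) => /negbT /negP[].
by apply/forallP=> a; apply/forallP=> b; apply/implyP=> /hs->.
Qed.

Lemma packs_add p W v (s : 'S_k) :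
    packs p W ->
    (forall u, u \in W -> adj u v -> forall i, ~~ K u v (p u i) (s i)) ->
  packs (update p v s) (v |: W).
Proof.
move=> pW hs a b; rewrite !in_setU1 /update.
case: (eqVneq a v) => [->|_]; case: (eqVneq b v) => [->|_] //=.
- by rewrite adj_irrefl.
- by move=> _ bW vb i; rewrite K_sym; apply: hs; rewrite // adj_sym.
- by move=> aW _; apply: hs.
- exact: pW.
Qed.

Lemma packs_add_apart p W v (s : 'S_k) :
    packs p W ->
    (forall u, u \in W -> adj u v -> apart (p u * extension u v) s) ->
  packs (update p v s) (v |: W).
Proof.
move=> pW hs; apply: packs_add => // u uW uv i; apply/negP=> /(extensionP uv).
by have /apartP/(_ i) := hs u uW uv; rewrite permM.
Qed.

Definition blockers p W v :=
  [seq (p u * extension u v)%g | u in [set u in W | adj v u]].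

Lemma size_blockers p W v : size (blockers p W v) = degree_in W v.
Proof. by rewrite size_map -cardE. Qed.

Lemma blockersP p W v u :
  u \in W -> adj u v -> (p u * extension u v)%g \in blockers p W v.
Proof. by move=> uW uv; apply: image_f; rewrite inE uW adj_sym. Qed.

(* Greedy reduction: a vertex with at most d <= k / 2 neighbours in U is packed
   last, so only the sets U without such a vertex need attention. *)
Lemma packs_dense d :
    2 * d <= k ->
    (forall U, U != set0 -> (forall v, v \in U -> d < degree_in U v) ->
       (forall W, W \proper U -> exists p, packs p W) -> exists p, packs p U) ->
  forall U, exists p, packs p U.
Proof.
move=> dk dense U; have [n] := ubnP #|U|.
elim: n U => // n IHn U; rewrite ltnS => leUn.
have IH W : W \proper U -> exists p, packs p W.
  by move/proper_card => ltWU; apply: IHn; lia.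
have [->|U0] := eqVneq U set0.
  by exists (fun=> 1%g) => u v; rewrite inE.
have [/exists_inP[v vU sparse]|none] :=
  boolP [exists v in U, degree_in U v <= d]; last first.
  apply: dense => // v vU; rewrite ltnNge; apply: contra none => h.
  by apply/exists_inP; exists v.
have [p pW] := IH _ (properD1 vU).
have [|s hs] := @exists_apart _ (blockers p (U :\ v) v).
  rewrite card_ord size_blockers.
  by move: sparse; rewrite (degree_inD1 U v v); lia.
exists (update p v s); rewrite -(setD1K vU); apply: packs_add_apart => // u uW uv.
exact/hs/blockersP.
Qed.

End Packing.

Lemma packs_six (G : sgraph) (K : G -> G -> rel 'I_6) :
    max_degree G <= 4 -> (forall u v x y, K u v x y = K v u y x) ->
    (forall u v, adj u v -> exists s : 'S_6, forall x y, K u v x y -> s x = y) ->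
  exists p, packs K p [set: G].
Proof.
move=> maxG K_sym K_matching.
apply: (packs_dense K_sym K_matching (d := 3)) => // U.
case/set0Pn=> v vU dense IH.
have /card_gt0P[u] : 0 < degree_in U v by have := dense v vU; lia.
rewrite inE => /andP[uU vu]; have uv : adj u v by rewrite adj_sym.
have u'v : u != v by apply: contraTneq uv => ->; rewrite adj_irrefl.
set W := U :\ v :\ u.
have eU : U = v |: (u |: W) by rewrite /W !setD1K // !inE u'v.
have [|p pW] := IH W.
  by apply: sub_proper_trans (properD1 vU); apply: subsetDl.
have Wu : degree_in W u <= 3.
  have := degree_in_max U u; rewrite (degree_inD1 U u v) (degree_inD1 _ u u) vU uv.
  rewrite -/W; lia.
have Wv : degree_in W v <= 3.
  have := degree_in_max U v; rewrite (degree_inD1 U v v) (degree_inD1 _ v u) !inE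
    u'v uU vu.
  rewrite -/W; lia.
(* The default pads the at most three blockers of [v] with identities, which only adds
   constraints. *)
pose B (i : 'I_3) := nth 1%g (blockers K p W v) i.
have [|s [t [hs ht st]]] := exists_apart_pair
    (As := [seq (A * extension K u v)%g | A <- blockers K p W u]) B (card_ord 6).
  by rewrite size_map size_blockers.
have h u1 : u1 \in W -> u1 != u by rewrite !inE => /and3P[].
(* The permutation [s] was chosen in the colours of [v] and is carried back to those of [u]. *)
exists (update (update p u (s * (extension K u v)^-1)%g) v t); rewrite eU.
apply: (packs_add_apart K_sym K_matching).
  apply: (packs_add_apart K_sym K_matching) => // w wW wu.
  rewrite -(apartMr _ _ (extension K u v)) mulgKV; apply: hs.
  exact/map_f/blockersP.
move=> w; rewrite in_setU1 /update => /orP[/eqP->|wW] wv.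
  by rewrite eqxx mulgKV.
rewrite (negPf (h w wW)).
have /(nthP 1%g)[i lti <-] := blockersP K p wW wv.
have lti3 : i < 3 by apply: leq_trans lti _; rewrite size_blockers.
exact: (ht (Ordinal lti3)).
Qed.

Lemma packs_four (G : sgraph) (K : G -> G -> rel 'I_4) :
    max_degree G <= 3 -> (forall u v x y, K u v x y = K v u y x) ->
    (forall u v, adj u v -> exists s : 'S_4, forall x y, K u v x y -> s x = y) ->
  exists p, packs K p [set: G].
Proof.
move=> maxG K_sym K_matching.
apply: (packs_dense K_sym K_matching (d := 2)) => // U.
case/set0Pn=> v vU dense IH.
have /card_gt1P[a [b]] : 1 < degree_in U v by have := dense v vU; lia.
rewrite !inE => -[/andP[aU va] /andP[bU vb] a'b].
have av : adj a v by rewrite adj_sym.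
have bv : adj b v by rewrite adj_sym.
have a'v : a != v by apply: contraTneq va => ->; rewrite adj_irrefl.
have b'v : b != v by apply: contraTneq vb => ->; rewrite adj_irrefl.
have b'a : b != a by rewrite eq_sym.
set W := U :\ v :\ b :\ a.
have eU : U = v |: (b |: (a |: W)) by rewrite /W !setD1K // !inE ?a'b ?a'v ?b'v.
have [|p pW] := IH W.
  apply: sub_proper_trans (properD1 vU).
  by apply: subset_trans (subsetDl _ _) (subsetDl _ _).
(* If [a] and [b] are adjacent, each has at most one neighbour in [W] (triangle); otherwise at most
   two (induced path). *)
have Wa : degree_in W a + adj a b <= 2.
  have := degree_in_max U a; rewrite (degree_inD1 U a v) (degree_inD1 _ a b)
    (degree_inD1 _ a a).
  by rewrite -/W vU av !inE b'v bU /=; clear -maxG; lia.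
have Wb : degree_in W b + adj a b <= 2.
  have := degree_in_max U b; rewrite (degree_inD1 U b v) (degree_inD1 _ b b)
    (degree_inD1 _ b a).
  by rewrite -/W vU bv !inE a'v aU a'b [adj b a]adj_sym /=; clear -maxG; lia.
have Wv : degree_in W v <= 1.
  have := degree_in_max U v; rewrite (degree_inD1 U v v) (degree_inD1 _ v b)
    (degree_inD1 _ v a).
  by rewrite -/W !inE a'v aU a'b b'v bU va vb /=; clear -maxG; lia.
have Wa' w : w \in W -> w != a by rewrite !inE => /and3P[].
have Wb' w : w \in W -> w != b by rewrite !inE => /and4P[].
pose Pa := extension K a v; pose Pb := extension K b v; pose Pab := extension K a b.
(* Everything is read in the colours of v: x, y, t are the packings of a, b, v. *)
suff [x [y [t [[hx hy ht] xt yt xy]]]] : exists x y t : 'S_4,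
    [/\ [/\ forall A, A \in blockers K p W a -> apart (A * Pa) x,
            forall A, A \in blockers K p W b -> apart (A * Pb) y
          & forall A, A \in blockers K p W v -> apart A t],
        apart x t, apart y t & adj a b -> apart (x * (Pa^-1 * Pab * Pb)) y].
  exists (update (update (update p a (x * Pa^-1)%g) b (y * Pb^-1)%g) v t).
  rewrite eU; apply: (packs_add_apart K_sym K_matching).
    apply: (packs_add_apart K_sym K_matching).
      apply: (packs_add_apart K_sym K_matching) => // w wW wa.
      by rewrite -(apartMr _ _ Pa) mulgKV; apply/hx/blockersP.
    move=> w; rewrite in_setU1 /update -(apartMr _ _ Pb) mulgKV =>
      /orP[/eqP->|wW] wb.
      by rewrite eqxx -!mulgA in xy *; apply: xy.
    by rewrite (negPf (Wa' w wW)); apply/hy/blockersP.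
  move=> w; rewrite !in_setU1 /update => /or3P[/eqP->|/eqP->|wW] wv.
  - by rewrite eqxx mulgKV.
  - by rewrite (negPf a'b) eqxx mulgKV.
  - by rewrite (negPf (Wa' w wW)) (negPf (Wb' w wW)); apply/ht/blockersP.
have [ab|nab] := boolP (adj a b).
  have {}Wa : degree_in W a <= 1 by move: Wa; rewrite ab addn1.
  have {}Wb : degree_in W b <= 1 by move: Wb; rewrite ab addn1.
  have [x [y [t [[hx hy ht] [xy xt yt]]]]] := triangle_perms
    (nth 1%g (blockers K p W a) 0 * Pa) (nth 1%g (blockers K p W b) 0 * Pb)
    (nth 1%g (blockers K p W v) 0) (Pa^-1 * Pab * Pb).
  by exists x, y, t; split=> //; split=> A /(mem_size1 1%g)-> //;
    rewrite size_blockers.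
have [x [y [t [[hx1 hx2 hy1 hy2] [ht xt yt]]]]] := path_perms
  (nth 1%g (blockers K p W a) 0 * Pa) (nth 1%g (blockers K p W a) 1 * Pa)
  (nth 1%g (blockers K p W b) 0 * Pb) (nth 1%g (blockers K p W b) 1 * Pb)
  (nth 1%g (blockers K p W v) 0).
exists x, y, t; split=> //; split=> A.
- by case/(mem_size2 1%g)=> [|->|->] //;
    rewrite size_blockers (leq_trans (leq_addr _ _) Wa).
- by case/(mem_size2 1%g)=> [|->|->] //;
    rewrite size_blockers (leq_trans (leq_addr _ _) Wb).
- by move/(mem_size1 1%g)->; rewrite // size_blockers.
Qed.

Lemma greedy_coloring (G : sgraph) k (U : {set G}) :
    max_degree G <= k ->
  exists f : G -> 'I_k.+1, {in U &, forall u v, adj u v -> f u != f v}.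
Proof.
move=> maxG; have [n] := ubnP #|U|; elim: n U => // n IHn U; rewrite ltnS => leUn.
have [->|[v vU]] := set_0Vmem U; first by exists (fun=> ord0) => u v; rewrite inE.
have [|f hf] := IHn (U :\ v); first by have := cardsD1 v U; rewrite vU; lia.
have /subsetPn[c _ hc] : ~~ ([set: 'I_k.+1] \subset f @: [set u in U :\ v | adj v
  u]).
  apply/negP=> /subset_leq_card; rewrite cardsT card_ord ltnNge => /negP[].
  apply: leq_trans (leq_imset_card _ _) _.
  exact: leq_trans (degree_in_max (U :\ v) v) maxG.
have fc u : u \in U -> u != v -> adj u v -> f u != c.
  move=> uU u'v uv; apply: contraNneq hc => <-; apply: imset_f.
  by rewrite !inE u'v uU adj_sym.
exists (update f v c) => u w uU wU; rewrite /update.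
case: (eqVneq u v) => [->|u'v]; case: (eqVneq w v) => [->|w'v] uw.
- by rewrite adj_irrefl in uw.
- by rewrite eq_sym fc // adj_sym.
- exact: fc.
- by apply: hf; rewrite // !inE ?u'v ?w'v.
Qed.

(** The alternatives for an edge model equal lists, where only equal indices conflict, and different
    lists, where some colour [z] of [u] has no partner at [v]. *)
Lemma packs_three (G : sgraph) (K : G -> G -> rel 'I_3) :
    max_degree G <= 2 -> (forall u v x y, K u v x y = K v u y x) ->
    (forall u v, adj u v -> (forall x y, K u v x y -> x = y) \/
       exists (s : 'S_3) z, forall x y, K u v x y -> s x = y /\ x <> z) ->
  exists p, packs K p [set: G].
Proof.
move=> maxG K_sym K_cases.
have K_matching u v : adj u v -> exists s : 'S_3, forall x y, K u v x y -> s x = y.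
  case/K_cases=> [e|[s [z h]]]; last by exists s => x y /h[].
  by exists 1%g => x y /e->; rewrite perm1.
apply: (packs_dense K_sym K_matching (d := 1)) => // U _ _ IH.
have [|same] := boolP [exists u in U, exists v in U,
    adj u v && ~~ [forall x, forall y, K u v x y ==> (x == y)]]; last first.
  have [f hf] := greedy_coloring U maxG.
  (* The rotation by [f v] in Z/3: in every colouring, adjacent vertices have different indices. *)
  exists (fun v => perm (@GRing.addIr _ (f v))) => u v uU vU uv i.
  apply/negP; rewrite !permE => Kuv; have /eqP[] := hf u v uU vU uv.
  apply: (@GRing.addrI _ i); apply/eqP; apply: contraNT same => ne.
  apply/exists_inP; exists u => //; apply/exists_inP; exists v; rewrite ?uv //=.
  apply: contra ne => /forallP/(_ (i + f u)%R)/forallP/(_ (i + f v)%R).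
  by rewrite Kuv.
case/exists_inP=> u uU /exists_inP[v vU /andP[uv ne]].
have {ne} [s [z hs]] : exists (s : 'S_3) z, forall x y, K u v x y -> s x = y /\ x
  <> z.
  case: (K_cases u v uv) => // e; case/negP: ne.
  by apply/forallP=> x; apply/forallP=> y; apply/implyP=> /e->.
have u'v : u != v by apply: contraTneq uv => ->; rewrite adj_irrefl.
set W := U :\ v :\ u.
have eU : U = v |: (u |: W) by rewrite /W !setD1K // !inE u'v.
have [|p pW] := IH W.
  by apply: sub_proper_trans (properD1 vU); apply: subsetDl.
have Wu : degree_in W u <= 1.
  have := degree_in_max U u; rewrite (degree_inD1 U u v) (degree_inD1 _ u u) vU uv.
  rewrite -/W; lia.
have Wv : degree_in W v <= 1.
  have := degree_in_max U v; rewrite (degree_inD1 U v v) (degree_inD1 _ v u).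
  rewrite !inE u'v uU [adj v u]adj_sym uv -/W; lia.
(* Read in the colours of [v], [z] becomes [s z]: agreement there is harmless. *)
have [x [y [hx hy xy]]] := edge_perms (nth 1%g (blockers K p W u) 0 * s)
  (nth 1%g (blockers K p W v) 0) (s z).
exists (update (update p u (x * s^-1)%g) v y); rewrite eU; apply: (packs_add K_sym).
  apply: (packs_add_apart K_sym K_matching) => // w wW wu.
  rewrite -(apartMr _ _ s) mulgKV;
    move: (blockersP K p wW wu) => /(mem_size1 1%g)->//.
  by rewrite size_blockers.
move=> w; rewrite in_setU1 /update => /orP[/eqP->|wW] wv i; apply/negP.
  rewrite eqxx permM => /hs[]; rewrite permKV => /xy->.
  by rewrite permK.
have w'u : w != u by move: wW; rewrite !inE => /and3P[].
rewrite (negPf w'u) => /(extensionP K_matching wv).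
move: (blockersP K p wW wv) => /(mem_size1 1%g); rewrite size_blockers => /(_ Wv) e.
by have /apartP/(_ i) := hy; rewrite -e permM.
Qed.

(** * Covers *)

Section Cover.
Variables (G H : sgraph) (k : nat) (L : G -> {set H}) (e : G -> 'I_k -> H).
Hypothesis L_cover : kfold_cover k L.
Hypothesis e_inj : forall v, injective (e v).
Hypothesis e_in : forall v i, e v i \in L v.

Definition conflict u v : rel 'I_k := fun x y => adj (e u x) (e v y).

Lemma conflict_sym u v x y : conflict u v x y = conflict v u y x.
Proof. exact: adj_sym. Qed.

Lemma conflict_matching u v :
  adj u v -> exists s : 'S_k, forall x y, conflict u v x y -> s x = y.
Proof.
move=> uv; have match_uv := cover_matching (proj1 L_cover) uv.
apply: perm_extension => [x y y'|x x' y] h h'; apply: e_inj.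
  by apply/(match_uv _ _ _ _ (e_in u x) (e_in u x) (e_in v y) (e_in v y') h h').
by apply/(match_uv _ _ _ _ (e_in u x) (e_in u x') (e_in v y) (e_in v y) h h').
Qed.

Lemma e_surj v x : x \in L v -> exists i, x = e v i.
Proof.
have -> : L v = e v @: setT.
  apply/eqP; rewrite eq_sym eqEcard (card_imset _ (@e_inj v)) cardsT card_ord.
  rewrite (proj2 L_cover) leqnn andbT.
  by apply/subsetP=> _ /imsetP[i _ ->].
by case/imsetP=> i _ ->; exists i.
Qed.

(** A cover vertex is coloured by the index of the colouring that uses it; conversely the clique
    [L v0] needs [k] colours. *)
Lemma chromatic_of_packing (v0 : G) p :
  packs conflict p [set: G] -> chromatic_number H = k.
Proof.
move=> pG; have [cov cardL] := L_cover.
have hit x : exists vi : G * 'I_k, x == e vi.1 (p vi.1 vi.2).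
  have: x \in \bigcup_v L v by rewrite (cover_total cov) inE.
  case/bigcupP=> v _ /e_surj[i ->]; exists (v, (p v)^-1%g i) => /=.
  by rewrite permKV.
pose f x := (xchoose (hit x)).2.
have fP x : x = e (xchoose (hit x)).1 (p (xchoose (hit x)).1 (f x)).
  exact: eqP (xchooseP (hit x)).
have colH : colorable H k.
  apply/existsP; exists [ffun x => f x]; apply/forallP=> x; apply/forallP=> y.
  apply/implyP=> xy; rewrite !ffunE; apply/eqP => fxy.
  move: xy; rewrite (fP x) (fP y) fxy.
  move: (xchoose (hit x)).1 (xchoose (hit y)).1 => u v.
  have [->|u'v] := eqVneq u v; first by rewrite adj_irrefl.
  apply/negP; have [uv|nuv] := boolP (adj u v).
    by apply: pG; rewrite ?inE.
  exact: cover_nonadj cov _ _ u'v nuv _ _ (e_in _ _) (e_in _ _).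
rewrite /chromatic_number; case: ex_minnP => m colm minm.
apply/eqP; rewrite eqn_leq minm //=.
case/existsP: colm => g /forallP hg.
rewrite -[k]card_ord -[m]card_ord;
  apply: (leq_card (fun i => g (e v0 i))) => i j gij.
apply/eqP; apply/idPn => i'j; have /forallP/(_ (e v0 j)) := hg (e v0 i).
rewrite gij eqxx implybF => /negP[]; apply: (cover_clique cov (v := v0)) => //.
by rewrite (inj_eq (@e_inj v0)).
Qed.

End Cover.

Lemma inhabited_of_degree (G : sgraph) : 0 < max_degree G -> exists v : G, true.
Proof.
case: (pickP (@predT G)) => [v _|none]; first by exists v.
by rewrite /max_degree big_pred0.
Qed.

Lemma correspondence_packable_of (G : sgraph) k :
    0 < max_degree G ->
    (forall K : G -> G -> rel 'I_k, (forall u v x y, K u v x y = K v u y x) ->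
       (forall u v, adj u v -> exists s : 'S_k, forall x y, K u v x y -> s x = y) ->
       exists p, packs K p [set: G]) ->
  correspondence_packable G k.
Proof.
move=> maxG allK H L LH.
have [v0 _] := inhabited_of_degree maxG.
pose e v (i : 'I_k) : H := enum_val (cast_ord (esym (proj2 LH v)) i).
have e_inj v : injective (e v) by move=> i j /enum_val_inj/cast_ord_inj.
have e_in v i : e v i \in L v by apply: enum_valP.
have [p hp] := allK (conflict e) (conflict_sym e) (conflict_matching LH e_inj e_in).
exact: (chromatic_of_packing LH e_inj e_in v0 hp).
Qed.

(** * List covers as correspondence covers *)

Section Lists.
Variables (G : sgraph) (k : nat) (L : G -> {fset nat}).
Hypothesis L_assign : list_assignment k L.

Lemma list_colour_in v (i : 'I_k) : nth 0 (enum_fset (L v)) i \in L v.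
Proof. by apply: mem_nth; rewrite [size _](L_assign v). Qed.

Definition list_vertex v (i : 'I_k) : list_cover L :=
  Tagged (fun v => L v) (FSetSub (list_colour_in v i)).

Definition list_part v : {set list_cover L} := [set q | tag q == v].

Lemma list_vertex_inj v : injective (list_vertex v).
Proof.
move=> i j /(congr1 (@list_cover_colour G L)) /eqP; rewrite /list_cover_colour /=.
by rewrite nth_uniq ?fset_uniq ?[size _](L_assign v) // => /eqP/val_inj.
Qed.

Lemma list_vertex_in v i : list_vertex v i \in list_part v.
Proof. by rewrite inE. Qed.

Lemma list_cover_inj (q r : list_cover L) :
  tag q = tag r -> list_cover_colour q = list_cover_colour r -> q = r.
Proof.
case: q r => [u x] [v y] /= uv; subst v;
  rewrite /list_cover_colour /= => /val_inj->.
by [].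
Qed.

Lemma list_cover_kfold : kfold_cover k list_part.
Proof.
split; first split.
- by apply/setP=> q; rewrite inE; apply/bigcupP; exists (tag q); rewrite ?inE.
- move=> u v u'v; rewrite -setI_eq0; apply/eqP/setP=> q; rewrite !inE.
  by apply/negP=> /andP[/eqP-> /eqP uv]; rewrite uv eqxx in u'v.
- move=> u v u'v nuv x y; rewrite !inE => /eqP xu /eqP yv; subst u v.
  by rewrite /adj /= /list_cover_adj (negPf u'v) (negPf nuv).
- move=> u v uv x x' y y'; rewrite !inE => /eqP xu /eqP x'u /eqP yv /eqP y'v.
  have u'v : u != v by apply: contraTneq uv => ->; rewrite adj_irrefl.
  rewrite /adj /= /list_cover_adj xu x'u yv y'v (negPf u'v) uv /= =>
    /eqP xy /eqP x'y'.
  split=> E; apply: list_cover_inj; first by rewrite yv y'v.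
  - by rewrite -xy -x'y' E.
  - by rewrite xu x'u.
  - by rewrite xy x'y' E.
- move=> v x y; rewrite !inE => /eqP xv /eqP yv x'y.
  rewrite /adj /= /list_cover_adj xv yv eqxx /=; apply/orP; left.
  by apply: contra x'y => /eqP xy; apply/eqP/list_cover_inj; rewrite ?xv ?yv.
move=> v; have -> : list_part v = list_vertex v @: setT.
  apply/setP=> q; rewrite inE; apply/eqP/imsetP => [|[i _ ->] //].
  case: q => u x /= uv; subst u.
  have ltx : index (val x) (enum_fset (L v)) < k.
    by rewrite -(L_assign v) index_mem; apply: valP.
  exists (Ordinal ltx); rewrite ?inE //; apply: list_cover_inj => //.
  by rewrite /list_cover_colour /= nth_index //; apply: valP.
by rewrite (card_imset _ (@list_vertex_inj v)) cardsT card_ord.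
Qed.

Lemma list_conflict_colour u v x y : adj u v -> conflict list_vertex u v x y ->
  nth 0 (enum_fset (L u)) x = nth 0 (enum_fset (L v)) y.
Proof.
move=> uv; have u'v : u != v by apply: contraTneq uv => ->; rewrite adj_irrefl.
by rewrite /conflict /adj /= /list_cover_adj /= (negPf u'v) /= => /andP[_ /eqP].
Qed.

(** Equal lists have the same enumeration. Different lists of equal size leave some [c] in [L u] but
    not in [L v], and its index is the required [z]. *)
Lemma list_conflict_cases u v : adj u v ->
  (forall x y, conflict list_vertex u v x y -> x = y) \/
  exists (s : 'S_k) z, forall x y, conflict list_vertex u v x y -> s x = y /\ x
    <> z.
Proof.
move=> uv; have [Luv|Luv] := eqVneq (L u) (L v); [left | right].
  move=> x y /(list_conflict_colour uv) /eqP; rewrite -Luv.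
  by rewrite nth_uniq ?fset_uniq ?[size _](L_assign u) // => /eqP/val_inj.
have /fsubsetPn[c cu cv] : ~~ (L u `<=` L v)%fset.
  by apply: contra Luv => sub; rewrite eqEfcard sub !L_assign /=.
have ltc : index c (enum_fset (L u)) < k by rewrite -(L_assign u) index_mem.
have [s hs] := conflict_matching list_cover_kfold list_vertex_inj list_vertex_in uv.
exists s, (Ordinal ltc) => x y xy; split; first exact: hs.
move=> xc; have := list_conflict_colour uv xy; rewrite xc nth_index // => ec.
by move: cv; rewrite ec list_colour_in.
Qed.

End Lists.

Lemma list_packable_of_correspondence (G : sgraph) k :
  correspondence_packable G k -> list_packable G k.
Proof. by move=> GK L hL; apply: GK (list_cover_kfold hL). Qed.

Lemma list_packable_three (G : sgraph) : max_degree G = 2 -> list_packable G 3.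
Proof.
move=> maxG L hL.
have [|v0 _] := @inhabited_of_degree G; first by rewrite maxG.
have [|p hp] := packs_three (K := conflict (list_vertex hL)) _ (conflict_sym _)
  (list_conflict_cases hL); first by rewrite maxG.
exact: (chromatic_of_packing (list_cover_kfold hL) (@list_vertex_inj _ _ _ hL)
  (list_vertex_in hL) v0 hp).
Qed.

(** Descent by excluded middle, [P] being an arbitrary predicate. *)
Lemma least_positive_le (P : nat -> Prop) n :
  0 < n -> P n -> exists k, least_positive P k /\ k <= n.
Proof.
have [m] := ubnP n; elim: m n => // m IH n; rewrite ltnS => lenm n0 Pn.
case: (classic (exists j, [/\ 0 < j, P j & j < n])) => [[j [j0 Pj ltjn]]|none].
  have [|k [lk lekj]] := IH j _ j0 Pj; first exact: leq_trans ltjn lenm.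
  by exists k; split=> //; apply: leq_trans lekj (ltnW ltjn).
exists n; split=> //; split=> // j j0 Pj; rewrite leqNgt; apply/negP=> ltjn.
by case: none; exists j.
Qed.

Theorem theorem4 :
  (forall G : sgraph,
     max_degree G = 2 \/ max_degree G = 3 ->
     exists k : nat,
       is_list_packing_number G k /\ k <= max_degree G + 1)
  /\
  (forall G : sgraph,
     max_degree G = 2 \/ max_degree G = 3 \/ max_degree G = 4 ->
     exists k : nat,
       is_correspondence_packing_number G k
       /\ k <= 2 * uphalf (max_degree G + 1)).
Proof.
(* Four is the bound for degree 3 in (i) and for degrees 2 and 3 in (ii), where rounding up to an
   even number makes them coincide. *)
have four (G : sgraph) : 0 < max_degree G <= 3 -> correspondence_packable G 4.
  by case/andP=> G0 G3; apply: correspondence_packable_of => // K;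
    apply: packs_four.
split=> G.
  case=> dG; rewrite dG; apply: least_positive_le => //.
    exact: list_packable_three.
  by apply/list_packable_of_correspondence/four; rewrite dG.
case=> [|[]] dG; rewrite dG; apply: least_positive_le => //; try
  by apply: four; rewrite dG.
by apply: correspondence_packable_of => [|K]; rewrite ?dG //; apply: packs_six;
  rewrite dG.
Qed.
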